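(* Let $a,b,t$ be complex numbers. Let $f_3(z,a,b)=\sum_{n\ge0}c(n,3,a,b)z^n$ be the unique formal power series with $f_3=1+azf_3+bz^3f_3^2$, and define $C(n,3,a,b,t)$ by $\sum_{n\ge0}C(n,3,a,b,t)z^n=\frac{f_3}{1-tzf_3}$. Let $d_0^{(3)}(N,a,b)=\det\big(c(i+j,3,a,b)\big)_{i,j=0}^{N-1}$ and $D_0^{(3)}(N,a,b,t)=\det\big(C(i+j,3,a,b,t)\big)_{i,j=0}^{N-1}$. Then for all $n\ge0$ $$d_0^{(3)}(3n,a,b)=(-1)^nb^{n(3n-1)},\quad d_0^{(3)}(3n+1,a,b)=(-1)^nb^{n(3n+1)},\quad d_0^{(3)}(3n+2,a,b)=0,$$ and $D_0^{(3)}(N,a,b,t)=d_0^{(3)}(N,a,b)$ for all $N\ge0$.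
   Context: The determinant of a $0\times0$ matrix is $1$. *)

(* Defs.v *)
From mathcomp Require Import all_boot all_order all_algebra.
From mathcomp Require Export reals complex.

Set Implicit Arguments.
Unset Strict Implicit.
Unset Printing Implicit Defensive.

Import GRing.Theory.
Local Open Scope ring_scope.

(* The series \sum_n f n * z ^ n is identified with f; equality is [=1]. *)
Definition fps (K : nzRingType) := nat -> K.

Declare Scope fps_scope.
Delimit Scope fps_scope with fps.
Bind Scope fps_scope with fps.

Section Operations.
Variable K : nzRingType.
Implicit Types f g : fps K.

(* fps_mono c k is the monomial c * z ^ k *)
Definition fps_mono (c : K) (k : nat) : fps K :=
  fun n => if n == k then c else 0.
Definition fps_add f g : fps K := fun n => f n + g n.
Definition fps_sub f g : fps K := fun n => f n - g n.
Definition fps_mul f g : fps K := fun n => \sum_(i < n.+1) f i * g (n - i)%N.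

(* The solution of f = Phi f, when the n-th coefficient of Phi f only depends
   on the coefficients of f of index less than n; see fps_fixP. *)
Definition fps_fix (Phi : fps K -> fps K) : fps K :=
  fun n => iter n.+1 Phi (fun=> 0) n.

Definition fps_causal (Phi : fps K -> fps K) :=
  forall n f g, (forall k, (k < n)%N -> f k = g k) -> Phi f n = Phi g n.

Lemma fps_fixP Phi : fps_causal Phi -> fps_fix Phi =1 Phi (fps_fix Phi).
Proof.
move=> cPhi n.
have stab m m' k : (k < m)%N -> (k < m')%N ->
    iter m Phi (fun=> 0) k = iter m' Phi (fun=> 0) k.
  elim: m m' k => [//|m IHm] [//|m'] k; rewrite !ltnS => lekm lekm' /=.
  by apply: cPhi => j ltjk; apply: IHm; apply: leq_trans ltjk _.
by rewrite {1}/fps_fix /=; apply: cPhi => k ltkn; apply: stab.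
Qed.

Lemma fps_fix_unique Phi f :
  fps_causal Phi -> f =1 Phi f -> f =1 fps_fix Phi.
Proof.
move=> cPhi fE n; elim/ltn_ind: n => n IHn.
by rewrite fE fps_fixP //; apply: cPhi.
Qed.

End Operations.

Notation "c *z^ k" := (fps_mono c%R k%N)
  (at level 30, k at level 8, format "c  *z^ k") : fps_scope.
Notation "1" := (fps_mono 1%R 0%N) : fps_scope.
Notation "f + g" := (fps_add f g) : fps_scope.
Notation "f - g" := (fps_sub f g) : fps_scope.
Notation "f * g" := (fps_mul f g) : fps_scope.

(* The coefficients h n of 1 / g, from
   g 0 * h n + \sum_(1 <= j < n.+1) g j * h (n - j) = (n == 0). *)
Definition fps_inv (K : unitRingType) (g : fps K) : fps K :=
  fps_fix (fun h n =>
    (g 0%N)^-1 * ((n == 0%N)%:R - \sum_(i < n) g i.+1 * h (n - i.+1)%N)).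

Definition fps_div (K : unitRingType) (f g : fps K) : fps K :=
  fps_mul f (fps_inv g).

Notation "f / g" := (fps_div f g) : fps_scope.

Lemma fps_mulV (K : unitRingType) (g : fps K) :
  g 0%N \is a GRing.unit -> (g * fps_inv g =1 1)%fps.
Proof.
move=> g0 n; rewrite /fps_mul big_ord_recl subn0.
rewrite {1}/fps_inv fps_fixP; last first.
  move=> m h h' eqh; congr (_ * (_ - _)); apply: eq_bigr => i _.
  by rewrite eqh // ltn_subrL (leq_ltn_trans _ (ltn_ord i)).
by rewrite mulrA divrr // mul1r subrK /fps_mono; case: (n == 0%N).
Qed.

Lemma fps_monoM (K : nzRingType) (c : K) k (f : fps K) n :
  (c *z^ k * f)%fps n = if (k <= n)%N then c * f (n - k)%N else 0.
Proof.
rewrite /fps_mul /fps_mono; case: leqP => [lekn|ltnk].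
  rewrite (bigD1 (Ordinal (lekn : (k < n.+1)%N))) //= eqxx big1 ?addr0 //.
  move=> i; rewrite -val_eqE /= => /negPf ->; by rewrite mul0r.
rewrite big1 // => i _; case: eqP => [ik|]; last by rewrite mul0r.
by have := ltn_ord i; rewrite ik ltnS leqNgt ltnk.
Qed.

Lemma f3_exists_unique (K : nzRingType) (a b : K) :
  let Phi (f : fps K) := (1 + a *z^ 1 * f + b *z^ 3 * (f * f))%fps in
  exists2 f, f =1 Phi f & forall g, g =1 Phi g -> g =1 f.
Proof.
move=> Phi.
have cPhi : fps_causal Phi.
  move=> n f g eqfg; rewrite /Phi /fps_add !fps_monoM.
  congr (_ + _ + _); case: ifP => // len.
    by rewrite eqfg // ltn_subrL.
  congr (_ * _); apply: eq_bigr => i _.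
  have lt3 : (n - 3 < n)%N by rewrite ltn_subrL (leq_trans _ len).
  rewrite !eqfg //; first by rewrite (leq_ltn_trans (leq_subr _ _)).
  by apply: leq_ltn_trans lt3; rewrite -ltnS.
exists (fps_fix Phi); first exact: fps_fixP.
by move=> g; apply: fps_fix_unique.
Qed.

Definition hankel_det (K : comNzRingType) (c : fps K) (N : nat) : K :=
  \det (\matrix_(i < N, j < N) c (i + j)%N).

(* Main.v *)
(** The Bezoutian of two power series is
      [bezoutian p q = (p(x) q(y) - p(y) q(x)) / (x - y)].
    It is bilinear and alternating, and multiplying both arguments by [u]
    multiplies it by [u(x) u(y)]; on coefficient matrices this is a congruence
    by a triangular Toeplitz matrix, so when [u(0) = 1] all leading principal
    minors are preserved.  The Hankel matrix of [c] is the coefficient matrix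
    of [bezoutian (z c) 1].

    The functional equation says [f v = 1] with [v = 1 - a z - b z^3 f], so the
    Hankel determinants of [f] and [z f] are leading principal minors of
      [bezoutian z v = 1 + b x y (bezoutian (z^2 f) 1)] and
      [bezoutian z^2 v = x + y - a x y + b x^2 y^2 (bezoutian (z f) 1)].
    The coefficient matrices are block diagonal, hence
    [d (N + 3) = - b^(2 N + 2) d N].  Likewise, with [u = 1 / (1 - t z f)], the
    Hankel determinants of [f u] are minors of
    [bezoutian (z f) (1 - t z f) = bezoutian (z f) 1]. *)

Require Import Defs.
From HB Require Import structures.
From mathcomp Require Import all_boot all_order all_algebra.
From mathcomp Require Import boolp ring zify.

Set Implicit Arguments.
Unset Strict Implicit.
Unset Printing Implicit Defensive.

Import GRing.Theory.
Local Open Scope ring_scope.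
Bind Scope ring_scope with fps.

(** * The ring of formal power series *)

Section FpsRing.
Variable K : comNzRingType.
Implicit Types f g h : fps K.

HB.instance Definition _ := gen_eqMixin (fps K).
HB.instance Definition _ := gen_choiceMixin (fps K).

Definition fps_zero : fps K := fun=> 0.
Definition fps_opp f : fps K := fun n => - f n.

Fact fps_addA : associative (@fps_add K).
Proof. by move=> f g h; apply/funext => n; rewrite /fps_add addrA. Qed.

Fact fps_addC : commutative (@fps_add K).
Proof. by move=> f g; apply/funext => n; rewrite /fps_add addrC. Qed.

Fact fps_add0r : left_id fps_zero (@fps_add K).
Proof. by move=> f; apply/funext => n; rewrite /fps_add add0r. Qed.

Fact fps_addNr : left_inverse fps_zero fps_opp (@fps_add K).
Proof. by move=> f; apply/funext => n; rewrite /fps_add addNr. Qed.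

HB.instance Definition _ :=
  GRing.isZmodule.Build (fps K) fps_addA fps_addC fps_add0r fps_addNr.

Lemma fps_mul_poly f g n m : (n < m)%N ->
  fps_mul f g n = ((\poly_(i < m) f i) * (\poly_(i < m) g i))`_n.
Proof.
move=> ltnm; rewrite coefM; apply: eq_bigr => i _.
have lein : (i <= n)%N by rewrite -ltnS.
rewrite !coef_poly (leq_ltn_trans lein ltnm).
by rewrite (leq_ltn_trans (leq_subr _ _) ltnm).
Qed.

Fact fps_mulC : commutative (@fps_mul K).
Proof.
by move=> f g; apply/funext => n; rewrite !(fps_mul_poly _ _ (ltnSn n)) mulrC.
Qed.

Fact fps_mulA : associative (@fps_mul K).
Proof.
move=> f g h; apply/funext => n.
pose trunc (u : fps K) := \poly_(i < n.+1) u i.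
transitivity (trunc f * trunc g * trunc h)`_n; last first.
  rewrite coefM; apply: eq_bigr => i _.
  by rewrite -fps_mul_poly // coef_poly ltnS leq_subr.
rewrite -mulrA coefM; apply: eq_bigr => i _.
by rewrite -fps_mul_poly ?ltnS ?leq_subr // coef_poly ltn_ord.
Qed.

Fact fps_mul1r : left_id (fps_mono (1 : K) 0) (@fps_mul K).
Proof. by move=> f; apply/funext => n; rewrite fps_monoM subn0 mul1r. Qed.

Fact fps_mulrDl : left_distributive (@fps_mul K) (@fps_add K).
Proof.
move=> f g h; apply/funext => n; rewrite /fps_add /fps_mul -big_split /=.
by apply: eq_bigr => i _; rewrite mulrDl.
Qed.

Fact fps_oner_neq0 : fps_mono (1 : K) 0 != 0 :> fps K.
Proof.
by apply/eqP => /(congr1 (fun f : fps K => f 0%N)) /eqP; rewrite oner_eq0.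
Qed.

HB.instance Definition _ := GRing.Zmodule_isComNzRing.Build (fps K)
  fps_mulA fps_mulC fps_mul1r fps_mulrDl fps_oner_neq0.

Lemma fps_oneE n : (1 : fps K) n = (n == 0)%:R. Proof. by case: n. Qed.
Lemma fps_addE f g n : (f + g) n = f n + g n. Proof. by []. Qed.
Lemma fps_oppE f n : (- f) n = - f n. Proof. by []. Qed.
Lemma fps_mulE f g n : (f * g) n = \sum_(i < n.+1) f i * g (n - i)%N.
Proof. by []. Qed.

Lemma fps_sumE (I : Type) (r : seq I) (P : pred I) (F : I -> fps K) n :
  (\sum_(i <- r | P i) F i) n = \sum_(i <- r | P i) F i n.
Proof. by elim/big_rec2: _ => // i x y _ <-. Qed.

Lemma fps_coef0M f g : (f * g) 0%N = f 0%N * g 0%N.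
Proof. by rewrite fps_mulE big_ord1. Qed.

Definition fpsC (c : K) : fps K := fps_mono c 0.
Definition fpsX : fps K := fps_mono 1 1.

Lemma fpsCM c f n : (fpsC c * f) n = c * f n.
Proof. by have := fps_monoM c 0 f n; rewrite subn0. Qed.

Lemma fpsXE n : fpsX n = (n == 1%N)%:R.
Proof. by rewrite /fpsX /fps_mono; case: (n == 1%N). Qed.

Lemma fpsXM f n : (fpsX * f) n = if n is m.+1 then f m else 0.
Proof. by rewrite [LHS]fps_monoM mul1r; case: n => // n; rewrite subn1. Qed.

Fact fpsC_is_zmod_morphism : zmod_morphism fpsC.
Proof.
by move=> c d; apply/funext => -[|n]; rewrite fps_addE fps_oppE //= subr0.
Qed.

Fact fpsC_is_monoid_morphism : monoid_morphism fpsC.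
Proof.
split=> // c d; apply/funext => n.
by rewrite fpsCM /fpsC /fps_mono; case: ifP; rewrite ?mulr0.
Qed.

HB.instance Definition _ :=
  GRing.isZmodMorphism.Build K (fps K) fpsC fpsC_is_zmod_morphism.
HB.instance Definition _ :=
  GRing.isMonoidMorphism.Build K (fps K) fpsC fpsC_is_monoid_morphism.

Lemma fps_monoE (c : K) k : fps_mono c k = fpsC c * fpsX ^+ k.
Proof.
apply/funext => n; rewrite fpsCM.
elim: k n => [|k IHk] n.
  by rewrite expr0 fps_oneE /fps_mono; case: (n == 0%N); rewrite ?mulr1 ?mulr0.
by rewrite exprS fpsXM; case: n => [|n]; rewrite ?mulr0 // -IHk.
Qed.

Lemma fpsXnM k f n :
  (fpsX ^+ k * f) n = if (k <= n)%N then f (n - k)%N else 0.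
Proof.
have <- : fps_mono 1 k = fpsX ^+ k by rewrite fps_monoE rmorph1 mul1r.
by rewrite [LHS]fps_monoM mul1r.
Qed.

End FpsRing.

(** * Bivariate series *)

Section Bivariate.
Variable K : comNzRingType.
Implicit Types (u p q c : fps K) (A B : fps (fps K)).

(* The coefficient of [x^i y^j] in [A] is [A i j]. *)
Definition inx u : fps (fps K) := fun i => fpsC (u i).
Definition iny u : fps (fps K) := fpsC u.

Fact inx_is_zmod_morphism : zmod_morphism inx.
Proof. by move=> u p; apply/funext => i; rewrite /inx fps_addE rmorphB. Qed.

Fact inx_is_monoid_morphism : monoid_morphism inx.
Proof.
split=> [|u p]; apply/funext => i; rewrite /inx.
  by rewrite !fps_oneE rmorph_nat.
by rewrite !fps_mulE rmorph_sum; apply: eq_bigr => k _; rewrite rmorphM.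
Qed.

HB.instance Definition _ := GRing.isZmodMorphism.Build (fps K) (fps (fps K))
  inx inx_is_zmod_morphism.
HB.instance Definition _ := GRing.isMonoidMorphism.Build (fps K) (fps (fps K))
  inx inx_is_monoid_morphism.
HB.instance Definition _ := GRing.RMorphism.copy iny (@fpsC (fps K)).

Local Notation x := (inx (fpsX K)).
Local Notation y := (iny (fpsX K)).

Lemma inxM u A i j : (inx u * A) i j = (u * (A^~ j : fps K)) i.
Proof. by rewrite !fps_mulE fps_sumE; under eq_bigr do rewrite fpsCM. Qed.

Lemma inyM u A i : (iny u * A) i = u * A i.
Proof. exact: fpsCM. Qed.

Lemma inxE u i j : inx u i j = u i * (j == 0)%:R.
Proof. by case: j => [|j]; rewrite ?mulr1 ?mulr0. Qed.

Lemma inyE u i j : iny u i j = (i == 0)%:R * u j.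
Proof. by case: i => [|i]; rewrite ?mul1r ?mul0r. Qed.

Lemma inxM_iny u p i j : (inx u * iny p) i j = u i * p j.
Proof. by rewrite mulrC inyM mulrC fpsCM. Qed.

Lemma inx_fpsC (k : K) : inx (fpsC k) = iny (fpsC k).
Proof. by apply/funext => -[|i] //; exact: (raddf0 (@fpsC K)). Qed.

Lemma lreg_subxy : GRing.lreg (x - y).
Proof.
apply: mulrI0_lreg => A; rewrite mulrBl => /subr0_eq xA_yA.
apply/funext => i; apply/funext => j.
have shift m : A i m = (y * A) i.+1 m by rewrite -xA_yA inxM fpsXM.
elim: j i shift => [|j IHj] i shift; rewrite shift inyM fpsXM //.
by apply: IHj => m; rewrite -xA_yA inxM fpsXM.
Qed.

Definition divided_difference p : fps (fps K) := fun i j => p (i + j).+1.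

Lemma divided_differenceE p :
  (x - y) * divided_difference p = inx p - iny p.
Proof.
rewrite mulrBl; apply/funext => i; apply/funext => j.
rewrite !fps_addE !fps_oppE inxM inyM !fpsXM /divided_difference.
by case: i j => [|i] [|j] /=; rewrite ?addn0 ?addnS ?subrr.
Qed.

Definition bezoutian p q : fps (fps K) :=
  divided_difference p * iny q - iny p * divided_difference q.

Lemma bezoutianE p q :
  (x - y) * bezoutian p q = inx p * iny q - iny p * inx q.
Proof.
rewrite /bezoutian mulrBr mulrA [in X in _ - X]mulrCA !divided_differenceE.
by ring.
Qed.

Lemma bezoutian_antisym p q : bezoutian q p = - bezoutian p q.
Proof. by rewrite /bezoutian; ring. Qed.

Lemma bezoutianpp p : bezoutian p p = 0.
Proof. by rewrite /bezoutian mulrC subrr. Qed.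

Lemma bezoutianBr p q c : bezoutian p (q - c) = bezoutian p q - bezoutian p c.
Proof.
by apply: lreg_subxy; rewrite [RHS]mulrBr !bezoutianE !rmorphB /=; ring.
Qed.

Lemma bezoutianZr (k : K) p q :
  bezoutian p (fpsC k * q) = iny (fpsC k) * bezoutian p q.
Proof.
apply: lreg_subxy; rewrite mulrCA !bezoutianE !rmorphM /= inx_fpsC.
by ring.
Qed.

Lemma bezoutianM2 u p q :
  bezoutian (u * p) (u * q) = inx u * (iny u * bezoutian p q).
Proof.
apply: lreg_subxy; rewrite 2![(x - y) * (_ * _)]mulrCA.
by rewrite !bezoutianE !rmorphM /=; ring.
Qed.

Lemma bezoutian_mulr u p :
  bezoutian u (u * p) = - (inx u * (iny u * bezoutian p 1)).
Proof. by rewrite -{1}[u]mulr1 bezoutianM2 bezoutian_antisym !mulrN. Qed.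

Lemma bezoutianp1 p : bezoutian p 1 = divided_difference p.
Proof.
by apply: lreg_subxy; rewrite bezoutianE divided_differenceE !rmorph1 !mulr1.
Qed.

Lemma bezoutianX1 : bezoutian (fpsX K) 1 = 1.
Proof. by apply: lreg_subxy; rewrite bezoutianE !rmorph1 mulr1; ring. Qed.

Lemma bezoutianXX1 : bezoutian (fpsX K * fpsX K) 1 = x + y.
Proof. by apply: lreg_subxy; rewrite bezoutianE !rmorph1 !rmorphM /=; ring. Qed.

End Bivariate.

(** * Leading principal minors *)

Section LeadingMinors.
Variable K : comNzRingType.
Implicit Types (u p q c v : fps K) (A B : fps (fps K)).

Local Notation x := (inx (fpsX K)).
Local Notation y := (iny (fpsX K)).

Definition leading_mx A N : 'M[K]_N := \matrix_(i, j) A i j.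
Definition leading_minor A N : K := \det (leading_mx A N).

Definition toeplitz_mx u N : 'M[K]_N :=
  \matrix_(i, j) if (j <= i)%N then u (i - j)%N else 0.

Lemma det_toeplitz_mx u N : \det (toeplitz_mx u N) = u 0%N ^+ N.
Proof.
rewrite det_trig; last first.
  by apply/is_trig_mxP => i j ltij; rewrite mxE leqNgt ltij.
under eq_bigr do rewrite mxE leqnn subnn.
by rewrite prodr_const card_ord.
Qed.

Lemma fps_mul_toeplitz u p N (i : 'I_N) :
  (u * p) i = \sum_(k < N) toeplitz_mx u N i k * p k.
Proof.
rewrite mulrC fps_mulE.
rewrite (big_ord_widen_cond N xpredT (fun k => p k * u (i - k)%N)) //=.
rewrite big_mkcond /=; apply: eq_bigr => k _.
by rewrite mxE ltnS mulrC; case: ifP; rewrite ?mul0r.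
Qed.

Lemma leading_mx_inxM u A N :
  leading_mx (inx u * A) N = toeplitz_mx u N *m leading_mx A N.
Proof.
apply/matrixP => i j; rewrite !mxE inxM fps_mul_toeplitz.
by apply: eq_bigr => k _; rewrite [leading_mx _ _ _ _]mxE.
Qed.

Lemma leading_mx_inyM u A N :
  leading_mx (iny u * A) N = leading_mx A N *m (toeplitz_mx u N)^T.
Proof.
apply/matrixP => i j; rewrite !mxE inyM fps_mul_toeplitz.
by apply: eq_bigr => k _; rewrite mulrC [leading_mx _ _ _ _]mxE [_^T _ _]mxE.
Qed.

Lemma leading_minor_inxM u A N :
  leading_minor (inx u * A) N = u 0%N ^+ N * leading_minor A N.
Proof. by rewrite /leading_minor leading_mx_inxM det_mulmx det_toeplitz_mx. Qed.

Lemma leading_minor_inyM u A N :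
  leading_minor (iny u * A) N = u 0%N ^+ N * leading_minor A N.
Proof.
rewrite /leading_minor leading_mx_inyM det_mulmx det_tr det_toeplitz_mx.
exact: mulrC.
Qed.

Lemma inxyXnM m A i j :
  (x ^+ m * (y ^+ m * A)) i j
  = if (m <= i)%N && (m <= j)%N then A (i - m)%N (j - m)%N else 0.
Proof.
by rewrite -!rmorphXn /= inxM fpsXnM inyM fpsXnM; case: (m <= i)%N.
Qed.

Lemma leading_minor_block m n A B :
    (forall i j, (m <= j)%N -> A i j = 0) ->
  leading_minor (A + x ^+ m * (y ^+ m * B)) (m + n)
  = leading_minor A m * leading_minor B n.
Proof.
move=> A0; rewrite /leading_minor -[X in \det X = _]submxK.
set M := leading_mx _ _; have -> : ursubmx M = 0.
  apply/matrixP => i j; rewrite !mxE !fps_addE inxyXnM /=.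
  by rewrite A0 ?leq_addr // leqNgt ltn_ord addr0.
rewrite det_lblock; congr (_ * _); congr (\det _); apply/matrixP => i j.
  by rewrite !mxE !fps_addE inxyXnM /= leqNgt ltn_ord addr0.
by rewrite !mxE !fps_addE inxyXnM /= A0 ?leq_addr // !addKn add0r.
Qed.

Lemma leading_minor1 A : leading_minor A 1 = A 0%N 0%N.
Proof. by rewrite /leading_minor det_mx11 mxE. Qed.

Lemma leading_minor2 A :
  leading_minor A 2 = A 0%N 0%N * A 1%N 1%N - A 0%N 1%N * A 1%N 0%N.
Proof.
rewrite /leading_minor (expand_det_row _ ord0) !big_ord_recl big_ord0 addr0.
by rewrite /cofactor !det_mx11 !mxE expr0 expr1 mul1r mulN1r mulrN.
Qed.

Lemma leading_minor_bezoutianM2 u p q N :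
  leading_minor (bezoutian (u * p) (u * q)) N
  = u 0%N ^+ (2 * N) * leading_minor (bezoutian p q) N.
Proof.
rewrite bezoutianM2 leading_minor_inxM leading_minor_inyM mulrA -exprD.
by rewrite addnn mul2n.
Qed.

Lemma hankel_det_bezoutian c N :
  hankel_det c N = leading_minor (bezoutian (fpsX K * c) 1) N.
Proof.
rewrite bezoutianp1; congr (\det _); apply/matrixP => i j; rewrite !mxE.
by rewrite /divided_difference fpsXM.
Qed.

Lemma hankel_det_mulV p u v N : v 0%N = 1 -> u * v = 1 ->
  hankel_det (p * u)%R N = leading_minor (bezoutian (fpsX K * p) v) N.
Proof.
move=> v0 uv1; have u0 : u 0%N = 1.
  by rewrite -[LHS]mulr1 -v0 -fps_coef0M uv1.
rewrite hankel_det_bezoutian mulrA mulrC -uv1 leading_minor_bezoutianM2 u0.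
by rewrite expr1n mul1r.
Qed.

Lemma hankel_det_invert_transform (t : K) p u N :
    (1 - fpsC t * fpsX K * p) * u = 1 ->
  hankel_det (p * u)%R N = hankel_det p N.
Proof.
rewrite mulrC -mulrA => uE; rewrite (hankel_det_mulV _ _ _ uE); last first.
  by rewrite fps_addE fps_oppE fpsCM fpsXM mulr0 subr0.
rewrite bezoutianBr bezoutianZr bezoutianpp mulr0 subr0.
exact/esym/hankel_det_bezoutian.
Qed.

End LeadingMinors.

(** * The cubic functional equation *)

Section CubicSeries.
Variables (K : comNzRingType) (a b : K) (f : fps K).
Local Notation X := (fpsX K).
Local Notation x := (inx X).
Local Notation y := (iny X).

Hypothesis fE : f = 1 + fpsC a * X * f + fpsC b * X ^+ 3 * (f * f).

Definition cubic_inverse : fps K := 1 - fpsC a * X - fpsC b * (X ^+ 3 * f).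

Lemma cubic_inverse0 : cubic_inverse 0%N = 1.
Proof.
rewrite /cubic_inverse !fps_addE !fps_oppE !fpsCM exprS -mulrA !fpsXM.
by rewrite !mulr0 !subr0.
Qed.

Lemma mulr_cubic_inverse : f * cubic_inverse = 1.
Proof.
rewrite /cubic_inverse.
transitivity (f - (fpsC a * X * f + fpsC b * X ^+ 3 * (f * f))); first by ring.
by rewrite {1}fE; ring.
Qed.

Lemma bezoutianX_cubic_inverse :
  bezoutian X cubic_inverse
  = 1 + x * (y * (iny (fpsC b) * bezoutian (X * (X * f)) 1)).
Proof.
have -> : cubic_inverse = 1 - fpsC a * X - fpsC b * (X * (X * (X * f))).
  by rewrite /cubic_inverse; ring.
rewrite !bezoutianBr !bezoutianZr bezoutianX1 bezoutianpp bezoutian_mulr.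
by ring.
Qed.

Lemma bezoutianXX_cubic_inverse :
  bezoutian (X * X) cubic_inverse
  = x + y - iny (fpsC a) * (x * y)
    + x ^+ 2 * (y ^+ 2 * (iny (fpsC b) * bezoutian (X * f) 1)).
Proof.
have -> : cubic_inverse = 1 - fpsC a * X - fpsC b * ((X * X) * (X * f)).
  by rewrite /cubic_inverse; ring.
rewrite !bezoutianBr !bezoutianZr bezoutianXX1 !bezoutian_mulr.
rewrite [bezoutian _ X]bezoutian_antisym bezoutian_mulr bezoutianX1 !rmorphM /=.
by ring.
Qed.

Lemma cubic_hankel_det_S N :
  hankel_det f N.+1 = b ^+ N * hankel_det (X * f)%R N.
Proof.
rewrite -{1}[f]mul1r (hankel_det_mulV _ _ cubic_inverse0 mulr_cubic_inverse).
rewrite mulr1 bezoutianX_cubic_inverse -add1n.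
rewrite (@leading_minor_block _ 1 N) => [|i [|j] //]; last first.
  by rewrite fps_oneE; case: (i == 0%N).
rewrite leading_minor_inyM -hankel_det_bezoutian leading_minor1.
exact: mul1r.
Qed.

Lemma cubic_hankel_det_fpsXM_SS N :
  hankel_det (X * f)%R N.+2 = - b ^+ N * hankel_det f N.
Proof.
rewrite (hankel_det_mulV _ _ cubic_inverse0 mulr_cubic_inverse).
have coefE i j : (x + y - iny (fpsC a) * (x * y)) i j
    = X i * (j == 0)%:R + (i == 0)%:R * X j - a * (X i * X j).
  by rewrite !fps_addE !fps_oppE inxE inyE inyM fpsCM inxM_iny.
rewrite bezoutianXX_cubic_inverse -[N.+2]add2n leading_minor_block; last first.
  by move=> i [|[|j]] // _; rewrite coefE !fpsXE !mulr0 !addr0 subrr.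
rewrite leading_minor_inyM -hankel_det_bezoutian leading_minor2.
by rewrite !coefE !fpsXE /=; ring.
Qed.

Lemma cubic_hankel_det_SSS N :
  hankel_det f N.+3 = - b ^+ (2 * N + 2) * hankel_det f N.
Proof.
rewrite cubic_hankel_det_S cubic_hankel_det_fpsXM_SS !mulNr mulrN mulrA -exprD.
by congr (- (b ^+ _ * _)); lia.
Qed.

Lemma cubic_hankel_det_mod3 n r :
  hankel_det f (3 * n + r)
  = (-1) ^+ n * b ^+ (n * (3 * n + 2 * r - 1)) * hankel_det f r.
Proof.
elim: n => [|n IHn]; first by rewrite !mul1r.
have -> : (n.+1 * (3 * n.+1 + 2 * r - 1)
    = n * (3 * n + 2 * r - 1) + (2 * (3 * n + r) + 2))%N by nia.
rewrite mulnS !addSn cubic_hankel_det_SSS IHn exprS [in RHS]exprD.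
by ring.
Qed.

Lemma cubic_hankel_det_initial_values :
  [/\ hankel_det f 0 = 1, hankel_det f 1 = 1 & hankel_det f 2 = 0].
Proof.
have det0 (c : fps K) : hankel_det c 0 = 1 by exact: det_mx00.
split; rewrite ?cubic_hankel_det_S ?det0 ?mul1r //.
by rewrite /hankel_det det_mx11 mxE fpsXM mulr0.
Qed.

End CubicSeries.

Theorem theorem6p1 (R : realType) (a b t : R[i]) (f F : fps R[i])
    (hf : (f =1 1 + a *z^ 1 * f + b *z^ 3 * (f * f))%fps)
    (hF : (F =1 f / (1 - t *z^ 1 * f))%fps) :
  (forall n : nat,
     [/\ hankel_det f (3 * n) = (-1) ^+ n * b ^+ (n * (3 * n - 1)),
         hankel_det f (3 * n + 1) = (-1) ^+ n * b ^+ (n * (3 * n + 1))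
       & hankel_det f (3 * n + 2) = 0])
  /\ (forall N : nat, hankel_det F N = hankel_det f N).
Proof.
split=> [n|N].
  have fE : f = 1 + fpsC a * fpsX _ * f + fpsC b * fpsX _ ^+ 3 * (f * f).
    by move/funext: hf; rewrite (fps_monoE a) (fps_monoE b) expr1.
  have [det0 det1 det2] := cubic_hankel_det_initial_values fE.
  split; last by rewrite (cubic_hankel_det_mod3 fE) det2 mulr0.
    rewrite -[X in hankel_det _ X]addn0 (cubic_hankel_det_mod3 fE) det0 mulr1.
    by rewrite muln0 addn0.
  by rewrite (cubic_hankel_det_mod3 fE) det1 mulr1 muln1 -addnBA.
rewrite (funext hF); apply: (@hankel_det_invert_transform _ t).
have : (1 - t *z^ 1 * f)%fps 0%N \is a GRing.unit.
  by rewrite /fps_sub fps_monoM subr0 unitr1.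
by move/fps_mulV/funext; rewrite (fps_monoE t) expr1.
Qed.
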